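(* Let $\mathcal{L}$ be a Lie algebra of a set-arrangement $\mathcal{A}$ on $X$. The following are equivalent: 1) $[x,\operatorname{im}(s_A')]=0$ for all $A\in\mathcal{A}$ and all $x\in X\setminus A$; 2) $\operatorname{im}(s_A')$ is an ideal in $\mathcal{L}$ for all $A\in\mathcal{A}$; 3) $\mathcal{L}'=\sum_{A\in\mathcal{A}}\operatorname{im}(s_A')$; 4) $s'$ is surjective; 5) $\pi'$ is injective. If these conditions are satisfied, then $$\mathcal{L}'=\bigoplus_{A\in\mathcal{A}}\operatorname{im}(s_A')\cong\bigoplus_{A\in\mathcal{A}}\mathcal{L}_A'$$ as Lie algebras.
   Context: Let $C$ be a commutative ring with unit. All Lie algebras are ordinary (non-super) Lie algebras over $C$; $\mathcal{F}(Y)$ denotes the free Lie algebra over $C$ on a set $Y$, and $\mathfrak{g}'=[\mathfrak{g},\mathfrak{g}]$ the derived Lie algebra. A set-arrangement on a finite set $X=\{x_1,\ldots,x_n\}$, $n\ge 2$, is a set $\mathcal{A}$ of subsets of $X$ such that each set in $\mathcal{A}$ has at least two elements, two different sets in $\mathcal{A}$ have at most one element in common, and the union of all the sets in $\mathcal{A}$ is $X$. A Lie algebra $\mathcal{L}$ of the set-arrangement $\mathcal{A}$ is a quotient of $\mathcal{F}(X)$ by the ideal generated by all $[x_i,x_j]$ such that $\{x_i,x_j\}$ is not a subset of any $A\in\mathcal{A}$, together with $R=\bigcup_{A\in\mathcal{A}}R_A$, where for each $A\in\mathcal{A}$, $R_A$ is a given subset of $\mathcal{F}(A)'=[\mathcal{F}(A),\mathcal{F}(A)]$.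 The localized Lie algebra at $A\in\mathcal{A}$ is $\mathcal{L}_A=\mathcal{F}(A)/\langle R_A\rangle$. For $A\in\mathcal{A}$, $s_A:\mathcal{L}_A\to\mathcal{L}$ is the natural Lie algebra morphism sending each generator in $A$ to itself, and $\pi_A:\mathcal{L}\to\mathcal{L}_A$ is the (well-defined) Lie algebra morphism sending all generators not in $A$ to zero and each generator in $A$ to itself. Their restrictions to derived algebras are $s_A':\mathcal{L}_A'\to\mathcal{L}'$ and $\pi_A':\mathcal{L}'\to\mathcal{L}_A'$. The $C$-module morphisms $s'$ and $\pi'$ are $$s'=\sum_{A\in\mathcal{A}}s_A':\ \bigoplus_{A\in\mathcal{A}}\mathcal{L}_A'\to\mathcal{L}',\qquad \pi'=\bigoplus_{A\in\mathcal{A}}\pi_A':\ \mathcal{L}'\to\bigoplus_{A\in\mathcal{A}}\mathcal{L}_A'.$$ In the final statement, direct sums of Lie algebras carry the componentwise bracket. *)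

(* Defs.v *)
From HB Require Import structures.
From mathcomp Require Import all_boot all_order all_algebra.
From mathcomp Require Import boolp classical_sets.

Set Implicit Arguments.
Unset Strict Implicit.
Unset Printing Implicit Defensive.

Import GRing.Theory.
Local Open Scope quotient_scope.
Local Open Scope classical_set_scope.
Local Open Scope ring_scope.

HB.mixin Record Lmodule_isLie (C : pzRingType) L of GRing.Lmodule C L := {
  br : L -> L -> L;
  brDl : forall x y z : L, br (x + y) z = br x z + br y z;
  brDr : forall x y z : L, br x (y + z) = br x y + br x z;
  brZl : forall (c : C) (x y : L), br (c *: x) y = c *: br x y;
  brZr : forall (c : C) (x y : L), br x (c *: y) = c *: br x y;
  brxx : forall x : L, br x x = 0;
  jacobi : forall x y z : L, br x (br y z) + br y (br z x) + br z (br x y) = 0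
}.

#[short(type="lieAlgType")]
HB.structure Definition LieAlg (C : pzRingType) :=
  {L of GRing.Lmodule C L & Lmodule_isLie C L}.

HB.mixin Record isLieMorphism (C : pzRingType) (L M : lieAlgType C)
  (f : L -> M) := {
  lie_morph : forall x y : L, f (br x y) = br (f x) (f y)
}.

#[short(type="lieMorph")]
HB.structure Definition LieMorphism (C : pzRingType) (L M : lieAlgType C) :=
  {f of @GRing.Linear C L M *:%R f & isLieMorphism C L M f}.

Definition lie_isomorphic (C : pzRingType) (L M : lieAlgType C) : Prop :=
  exists f : lieMorph L M, bijective f.

Section BracketTheory.
Variables (C : pzRingType) (L : lieAlgType C).
Implicit Types x y z : L.

Lemma br0x x : br 0 x = 0.
Proof. by rewrite -[X in br X _](scale0r (0 : L)) brZl scale0r. Qed.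

Lemma brx0 x : br x 0 = 0.
Proof. by rewrite -[X in br _ X](scale0r (0 : L)) brZr scale0r. Qed.

Lemma brC x y : br x y = - br y x.
Proof.
have := brxx (x + y); rewrite brDl !brDr !brxx add0r addr0 => /eqP.
by rewrite addr_eq0 => /eqP.
Qed.

Lemma brxN x y : br x (- y) = - br x y.
Proof. by rewrite -scaleN1r brZr scaleN1r. Qed.

Lemma brNx x y : br (- x) y = - br x y.
Proof. by rewrite -scaleN1r brZl scaleN1r. Qed.

End BracketTheory.

Section Sub.
Variables (C : pzRingType).

Definition is_submodule (V : lmodType C) (S : set V) : Prop :=
  [/\ S 0, forall x y, S x -> S y -> S (x + y) &
      forall (c : C) x, S x -> S (c *: x)].

Definition submodule_span (V : lmodType C) (S : set V) : set V :=
  [set x | forall T : set V, is_submodule T -> S `<=` T -> T x].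

Definition submodule_sum (V : lmodType C) (I : finType) (S : I -> set V) :
    set V :=
  [set x | exists2 v : I -> V, (forall i, S i (v i)) & x = \sum_i v i].

Variable L : lieAlgType C.

Definition is_lie_ideal (S : set L) : Prop :=
  is_submodule S /\ forall x y : L, S y -> S (br x y).

Definition ideal_span (S : set L) : set L :=
  [set x | forall T : set L, is_lie_ideal T -> S `<=` T -> T x].

Record lieSubalg := LieSubalg {
  lsub_set :> set L;
  lsub_submodule : is_submodule lsub_set;
  lsub_br : forall x y, lsub_set x -> lsub_set y -> lsub_set (br x y)
}.

Lemma submodule_spanP (S : set L) : is_submodule (submodule_span S).
Proof.
split=> [T [] //|x y Sx Sy T Tm ST|c x Sx T Tm ST].
- by case: (Tm) => _ + _; apply; [apply: Sx|apply: Sy].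
- by case: (Tm) => _ _; apply; apply: Sx.
Qed.

Lemma sub_submodule_span (S : set L) : S `<=` submodule_span S.
Proof. by move=> x Sx T _; apply. Qed.

Lemma ideal_spanP (S : set L) : is_lie_ideal (ideal_span S).
Proof.
split; first split=> [T [[]] //|x y Sx Sy T Tm ST|c x Sx T Tm ST].
- by case: (Tm) => -[_ + _] _; apply; [apply: Sx|apply: Sy].
- by case: (Tm) => -[_ _ + _]; apply; apply: Sx.
- by move=> x y Sy T Ti ST; case: (Ti) => _; apply; apply: Sy.
Qed.

Lemma sub_ideal_span (S : set L) : S `<=` ideal_span S.
Proof. by move=> x Sx T _; apply. Qed.

Lemma derived_br (x y : L) :
  submodule_span [set br u.1 u.2 | u in [set: L * L]] (br x y).
Proof. by apply: sub_submodule_span; exists (x, y). Qed.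

Definition derived_subalg : lieSubalg :=
  LieSubalg (submodule_spanP [set br u.1 u.2 | u in [set: L * L]])
    (fun x y _ _ => derived_br x y).

End Sub.

Definition lsub_pred (C : pzRingType) (L : lieAlgType C) (S : lieSubalg L) :
  {pred L} := fun x => `[< lsub_set S x >].

Lemma lsub_closed (C : pzRingType) (L : lieAlgType C) (S : lieSubalg L) :
  submod_closed (lsub_pred S).
Proof.
case: (lsub_submodule S) => S0 SD SZ; split; first exact/asboolP.
by move=> c x y /asboolP Sx /asboolP Sy; apply/asboolP/SD => //; apply: SZ.
Qed.

HB.instance Definition _ (C : pzRingType) (L : lieAlgType C)
  (S : lieSubalg L) := GRing.isSubmodClosed.Build C L (lsub_pred S)
    (lsub_closed S).

Record subalg (C : pzRingType) (L : lieAlgType C) (S : lieSubalg L) :=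
  Subalg { subalg_val :> L; subalg_valP : subalg_val \in lsub_pred S }.

HB.instance Definition _ C L S := [isSub for @subalg_val C L S].
HB.instance Definition _ C L S := [Choice of @subalg C L S by <:].
HB.instance Definition _ C L S :=
  [SubChoice_isSubLmodule of @subalg C L S by <:].

Section SubalgBr.
Variables (C : pzRingType) (L : lieAlgType C) (S : lieSubalg L).
Local Notation T := (subalg S).

Lemma subalg_set (x : T) : lsub_set S (val x).
Proof. exact/asboolP/(subalg_valP x). Qed.

Lemma subalg_br_subproof (x y : T) : br (val x) (val y) \in lsub_pred S.
Proof. by apply/asboolP/lsub_br; apply: subalg_set. Qed.

Definition subalg_br (x y : T) : T := Subalg (subalg_br_subproof x y).

Lemma subalg_brDl (x y z : T) :
  subalg_br (x + y) z = subalg_br x z + subalg_br y z.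
Proof. by apply: val_inj; rewrite /= brDl. Qed.
Lemma subalg_brDr (x y z : T) :
  subalg_br x (y + z) = subalg_br x y + subalg_br x z.
Proof. by apply: val_inj; rewrite /= brDr. Qed.
Lemma subalg_brZl (c : C) (x y : T) :
  subalg_br (c *: x) y = c *: subalg_br x y.
Proof. by apply: val_inj; rewrite /= brZl. Qed.
Lemma subalg_brZr (c : C) (x y : T) :
  subalg_br x (c *: y) = c *: subalg_br x y.
Proof. by apply: val_inj; rewrite /= brZr. Qed.
Lemma subalg_brxx (x : T) : subalg_br x x = 0.
Proof. by apply: val_inj; rewrite /= brxx. Qed.
Lemma subalg_jacobi (x y z : T) :
  subalg_br x (subalg_br y z) + subalg_br y (subalg_br z x) +
  subalg_br z (subalg_br x y) = 0.
Proof. by apply: val_inj; rewrite /= jacobi. Qed.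

HB.instance Definition _ := Lmodule_isLie.Build C T subalg_brDl subalg_brDr
  subalg_brZl subalg_brZr subalg_brxx subalg_jacobi.

End SubalgBr.

Definition derived (C : pzRingType) (L : lieAlgType C) : lieAlgType C :=
  subalg (derived_subalg L).

Section Morph.
Variables (C : pzRingType) (L M : lieAlgType C) (f : lieMorph L M).

Lemma der_morph_subproof (x : derived L) : f (val x) \in lsub_pred (derived_subalg M).
Proof.
apply/asboolP => T Tm ST; have /= := subalg_set x.
apply: (_ : _ -> (f @^-1` T) (val x)); apply.
  case: Tm => T0 TD TZ; split=> [|y z|c y]; rewrite /preimage /=.
  - by rewrite linear0.
  - by rewrite linearD; apply: TD.
  - by rewrite linearZ; apply: TZ.
by move=> _ [[u v] _ <-] /=; apply: ST; exists (f u, f v) => //=; rewrite lie_morph.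
Qed.

Definition der_morph (x : derived L) : derived M :=
  Subalg (der_morph_subproof x).

Lemma der_morph_is_linear : linear der_morph.
Proof. by move=> c x y; apply: val_inj; rewrite /= linearP. Qed.
HB.instance Definition _ := GRing.isLinear.Build C (derived L) (derived M) _
  der_morph der_morph_is_linear.

Lemma der_morph_is_lie (x y : derived L) :
  der_morph (br x y) = br (der_morph x) (der_morph y).
Proof. by apply: val_inj; rewrite /= lie_morph. Qed.
HB.instance Definition _ := isLieMorphism.Build C (derived L) (derived M)
  der_morph der_morph_is_lie.

Lemma image_submodule : is_submodule (range f).
Proof.
split=> [|_ _ [x _ <-] [y _ <-]|c _ [x _ <-]].
- by exists 0 => //; rewrite linear0.
- by exists (x + y) => //; rewrite linearD.
- by exists (c *: x) => //; rewrite linearZ.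
Qed.

Lemma image_br (x y : M) : range f x -> range f y -> range f (br x y).
Proof. by move=> [u _ <-] [v _ <-]; exists (br u v); rewrite ?lie_morph. Qed.

Definition lie_im : lieSubalg M := LieSubalg image_submodule image_br.

End Morph.

Section Comp.
Variables (C : pzRingType) (L M N : lieAlgType C).
Variables (f : lieMorph L M) (g : lieMorph M N).
Lemma comp_is_lie (x y : L) : (g \o f) (br x y) = br ((g \o f) x) ((g \o f) y).
Proof. by rewrite /= !lie_morph. Qed.
HB.instance Definition _ := isLieMorphism.Build C L N (g \o f) comp_is_lie.
End Comp.

(** The index type is finite, so the direct sum is the full product. *)
Definition dsum (C : pzRingType) (I : finType) (L : I -> lieAlgType C) : Type :=
  forall i, L i.

Section DSum.
Variables (C : pzRingType) (I : finType) (L : I -> lieAlgType C).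
Local Notation T := (dsum L).
HB.instance Definition _ := gen_eqMixin T.
HB.instance Definition _ := gen_choiceMixin T.

Let ext (u v : T) : (forall i, u i = v i) -> u = v.
Proof. exact: functional_extensionality_dep. Qed.

Definition dsum_zero : T := fun=> 0.
Definition dsum_opp (u : T) : T := fun i => - u i.
Definition dsum_add (u v : T) : T := fun i => u i + v i.
Lemma dsum_addA : associative dsum_add.
Proof. by move=> u v w; apply: ext => i; apply: addrA. Qed.
Lemma dsum_addC : commutative dsum_add.
Proof. by move=> u v; apply: ext => i; apply: addrC. Qed.
Lemma dsum_add0 : left_id dsum_zero dsum_add.
Proof. by move=> u; apply: ext => i; apply: add0r. Qed.
Lemma dsum_addN : left_inverse dsum_zero dsum_opp dsum_add.
Proof. by move=> u; apply: ext => i; apply: addNr. Qed.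
HB.instance Definition _ :=
  GRing.isZmodule.Build T dsum_addA dsum_addC dsum_add0 dsum_addN.

Definition dsum_scale (c : C) (u : T) : T := fun i => c *: u i.
Lemma dsum_scaleA a b u : dsum_scale a (dsum_scale b u) = dsum_scale (a * b) u.
Proof. by apply: ext => i; apply: scalerA. Qed.
Lemma dsum_scale1 : left_id 1 dsum_scale.
Proof. by move=> u; apply: ext => i; apply: scale1r. Qed.
Lemma dsum_scaleDr : right_distributive dsum_scale +%R.
Proof. by move=> c u v; apply: ext => i; apply: scalerDr. Qed.
Lemma dsum_scaleDl u : {morph dsum_scale^~ u : a b / a + b}.
Proof. by move=> a b; apply: ext => i; apply: scalerDl. Qed.
HB.instance Definition _ := GRing.Zmodule_isLmodule.Build C T
  dsum_scaleA dsum_scale1 dsum_scaleDr dsum_scaleDl.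

Definition dsum_br (u v : T) : T := fun i => br (u i) (v i).
Lemma dsum_brDl (x y z : T) : dsum_br (x + y) z = dsum_br x z + dsum_br y z.
Proof. by apply: ext => i; apply: brDl. Qed.
Lemma dsum_brDr (x y z : T) : dsum_br x (y + z) = dsum_br x y + dsum_br x z.
Proof. by apply: ext => i; apply: brDr. Qed.
Lemma dsum_brZl (c : C) (x y : T) : dsum_br (c *: x) y = c *: dsum_br x y.
Proof. by apply: ext => i; apply: brZl. Qed.
Lemma dsum_brZr (c : C) (x y : T) : dsum_br x (c *: y) = c *: dsum_br x y.
Proof. by apply: ext => i; apply: brZr. Qed.
Lemma dsum_brxx (x : T) : dsum_br x x = 0.
Proof. by apply: ext => i; apply: brxx. Qed.
Lemma dsum_jacobi (x y z : T) :
  dsum_br x (dsum_br y z) + dsum_br y (dsum_br z x) + dsum_br z (dsum_br x y)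
    = 0.
Proof. by apply: ext => i; apply: jacobi. Qed.
HB.instance Definition _ := Lmodule_isLie.Build C T dsum_brDl dsum_brDr
  dsum_brZl dsum_brZr dsum_brxx dsum_jacobi.

End DSum.

(** [L] is the internal direct sum, as a Lie algebra, of the subalgebras [S i]:
    the sum of the inclusions is an isomorphism from their external direct sum
    with the componentwise bracket. *)
Definition lie_internal_dsum (C : pzRingType) (L : lieAlgType C) (I : finType)
    (S : I -> lieSubalg L) : Prop :=
  exists f : lieMorph (dsum (fun i => subalg (S i))) L,
    (forall v, f v = \sum_i val (v i)) /\ bijective f.

(** [lie_quot S] is the quotient of [L] by the ideal generated by [S]. *)

Section Quot.
Variables (C : pzRingType) (L : lieAlgType C) (S : set L).

Definition ideal_pred : {pred L} := fun x => `[< ideal_span S x >].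

Lemma ideal_pred_closed : submod_closed ideal_pred.
Proof.
case: (ideal_spanP S) => -[S0 SD SZ] _; split; first exact/asboolP.
move=> c x y /asboolP Sx /asboolP Sy; apply/asboolP.
exact: (SD _ _ (SZ c x Sx) Sy).
Qed.
HB.instance Definition _ :=
  GRing.isSubmodClosed.Build C L ideal_pred ideal_pred_closed.

Definition lie_quot : Type := Quotient.quot ideal_pred.
HB.instance Definition _ := GRing.Zmodule.on lie_quot.

Definition quot_proj (x : L) : lie_quot := \pi_(Quotient.quot ideal_pred) x.

Lemma quot_projP (x y : L) :
  quot_proj x = quot_proj y <-> ideal_span S (x - y).
Proof.
have E := @Quotient.idealrBE L ideal_pred x y.
split=> [/eqP|Sxy]; last by apply/eqP; rewrite -[_ == _]E; apply/asboolP.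
by rewrite -[_ == _]E => /asboolP.
Qed.

Lemma quot_reprK (q : lie_quot) : quot_proj (repr q) = q.
Proof. exact: reprK. Qed.

Lemma quot_projD (x y : L) : quot_proj (x + y) = quot_proj x + quot_proj y.
Proof. by rewrite /quot_proj !piE. Qed.

Definition quot_scale (c : C) (q : lie_quot) : lie_quot :=
  quot_proj (c *: repr q).
Lemma quot_projZ c (x : L) : quot_scale c (quot_proj x) = quot_proj (c *: x).
Proof.
apply/quot_projP; rewrite -scalerBr; case: (ideal_spanP S) => -[_ _ SZ] _.
by apply: SZ; apply/quot_projP; apply: quot_reprK.
Qed.

Lemma quot_scaleA a b q : quot_scale a (quot_scale b q) = quot_scale (a * b) q.
Proof. by rewrite -[q]quot_reprK !quot_projZ scalerA. Qed.
Lemma quot_scale1 : left_id 1 quot_scale.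
Proof. by move=> q; rewrite -[q]quot_reprK !quot_projZ scale1r. Qed.
Lemma quot_scaleDr : right_distributive quot_scale +%R.
Proof.
move=> c p q; rewrite -[q]quot_reprK -[p]quot_reprK.
by rewrite !(quot_projZ, =^~ quot_projD) scalerDr.
Qed.
Lemma quot_scaleDl q : {morph quot_scale^~ q : a b / a + b}.
Proof.
move=> a b; rewrite -[q]quot_reprK.
by rewrite !quot_projZ -quot_projD scalerDl.
Qed.
HB.instance Definition _ := GRing.Zmodule_isLmodule.Build C lie_quot
  quot_scaleA quot_scale1 quot_scaleDr quot_scaleDl.

Definition quot_br (p q : lie_quot) : lie_quot :=
  quot_proj (br (repr p) (repr q)).
Lemma quot_proj_br (x y : L) :
  quot_br (quot_proj x) (quot_proj y) = quot_proj (br x y).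
Proof.
apply/quot_projP; set a := repr _; set b := repr _.
have Sa : ideal_span S (a - x) by apply/quot_projP; apply: quot_reprK.
have Sb : ideal_span S (b - y) by apply/quot_projP; apply: quot_reprK.
case: (ideal_spanP S) => -[_ SD SZ] SB.
have -> : br a b - br x y = br a (b - y) + (-1) *: br y (a - x).
  by rewrite scaleN1r -(brC (a - x) y) brDr brDl brxN brNx addrA subrK.
by apply: (SD); [exact: SB | apply: (SZ); exact: SB].
Qed.

Lemma quot_brDl (x y z : lie_quot) :
  quot_br (x + y) z = quot_br x z + quot_br y z.
Proof.
rewrite -[x]quot_reprK -[y]quot_reprK -[z]quot_reprK.
by rewrite !(quot_proj_br, =^~ quot_projD) brDl.
Qed.
Lemma quot_brDr (x y z : lie_quot) :
  quot_br x (y + z) = quot_br x y + quot_br x z.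
Proof.
rewrite -[x]quot_reprK -[y]quot_reprK -[z]quot_reprK.
by rewrite !(quot_proj_br, =^~ quot_projD) brDr.
Qed.
Lemma quot_brZl (c : C) (x y : lie_quot) :
  quot_br (c *: x) y = c *: quot_br x y.
Proof.
rewrite -[x]quot_reprK -[y]quot_reprK /GRing.scale /=.
by rewrite !(quot_proj_br, quot_projZ) brZl.
Qed.
Lemma quot_brZr (c : C) (x y : lie_quot) :
  quot_br x (c *: y) = c *: quot_br x y.
Proof.
rewrite -[x]quot_reprK -[y]quot_reprK /GRing.scale /=.
by rewrite !(quot_proj_br, quot_projZ) brZr.
Qed.
Lemma quot_proj0 : quot_proj 0 = 0.
Proof. by rewrite /quot_proj !piE. Qed.
Lemma quot_brxx (x : lie_quot) : quot_br x x = 0.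
Proof. by rewrite -[x]quot_reprK quot_proj_br brxx quot_proj0. Qed.
Lemma quot_jacobi (x y z : lie_quot) :
  quot_br x (quot_br y z) + quot_br y (quot_br z x) + quot_br z (quot_br x y)
    = 0.
Proof.
rewrite -[x]quot_reprK -[y]quot_reprK -[z]quot_reprK.
by rewrite !(quot_proj_br, =^~ quot_projD) jacobi quot_proj0.
Qed.
HB.instance Definition _ := Lmodule_isLie.Build C lie_quot quot_brDl quot_brDr
  quot_brZl quot_brZr quot_brxx quot_jacobi.

Lemma quot_proj_is_linear : linear quot_proj.
Proof. by move=> c x y; rewrite quot_projD -quot_projZ. Qed.
HB.instance Definition _ := GRing.isLinear.Build C L lie_quot _ quot_proj
  quot_proj_is_linear.
Lemma quot_proj_is_lie (x y : L) :
  quot_proj (br x y) = br (quot_proj x) (quot_proj y).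
Proof. by rewrite -quot_proj_br. Qed.
HB.instance Definition _ := isLieMorphism.Build C L lie_quot quot_proj
  quot_proj_is_lie.

End Quot.

Section QuotLift.
Variables (C : pzRingType) (L M : lieAlgType C) (S : set L).
Variables (f : lieMorph L M) (fS : forall x, S x -> f x = 0).

Definition quot_lift of (forall x, S x -> f x = 0) : lie_quot S -> M :=
  fun q => f (repr q).

Lemma ideal_span_ker x : ideal_span S x -> f x = 0.
Proof.
move/(_ (f @^-1` [set 0])); apply=> //; split.
  split=> [|y z|c y]; rewrite /preimage /=.
  - by rewrite linear0.
  - by move=> fy fz; rewrite linearD /= fy fz addr0.
  - by move=> fy; rewrite linearZ /= fy scaler0.
by move=> y z; rewrite /preimage /= lie_morph => ->; rewrite brx0.
Qed.

Lemma quot_lift_proj x : quot_lift fS (quot_proj S x) = f x.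
Proof.
apply/eqP; rewrite -subr_eq0 -linearB; apply/eqP/ideal_span_ker.
by apply/quot_projP; apply: quot_reprK.
Qed.

Lemma quot_lift_is_linear : linear (quot_lift fS).
Proof.
move=> c p q; rewrite -[p]quot_reprK -[q]quot_reprK -linearP.
by rewrite !quot_lift_proj linearP.
Qed.
HB.instance Definition _ := GRing.isLinear.Build C (lie_quot S) M _
  (quot_lift fS) quot_lift_is_linear.

Lemma quot_lift_is_lie p q :
  quot_lift fS (br p q) = br (quot_lift fS p) (quot_lift fS q).
Proof.
rewrite -[p]quot_reprK -[q]quot_reprK -lie_morph.
by rewrite !quot_lift_proj lie_morph.
Qed.
HB.instance Definition _ := isLieMorphism.Build C (lie_quot S) M
  (quot_lift fS) quot_lift_is_lie.

End QuotLift.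

(** The free Lie algebra over [C] on [Y]: formal Lie expressions modulo the
    congruence generated by the axioms of Lie algebras over [C]; see [free_lift]
    and [free_lift_unique] for its universal property. *)

Inductive lterm (C : pzRingType) (Y : Type) : Type :=
| LVar of Y
| LZero
| LOpp of lterm C Y
| LAdd of lterm C Y & lterm C Y
| LScale of C & lterm C Y
| LBr of lterm C Y & lterm C Y.
Arguments LVar {C Y}.
Arguments LZero {C Y}.

Inductive leqv (C : pzRingType) (Y : Type) : lterm C Y -> lterm C Y -> Prop :=
| leqv_refl s : leqv s s
| leqv_sym s t : leqv s t -> leqv t s
| leqv_trans s t u : leqv s t -> leqv t u -> leqv s u
| leqv_opp s s' : leqv s s' -> leqv (LOpp s) (LOpp s')
| leqv_add s s' t t' : leqv s s' -> leqv t t' -> leqv (LAdd s t) (LAdd s' t')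
| leqv_scale c s s' : leqv s s' -> leqv (LScale c s) (LScale c s')
| leqv_br s s' t t' : leqv s s' -> leqv t t' -> leqv (LBr s t) (LBr s' t')
| leqv_addA s t u : leqv (LAdd s (LAdd t u)) (LAdd (LAdd s t) u)
| leqv_addC s t : leqv (LAdd s t) (LAdd t s)
| leqv_add0 s : leqv (LAdd LZero s) s
| leqv_addN s : leqv (LAdd (LOpp s) s) LZero
| leqv_scaleA a b s : leqv (LScale a (LScale b s)) (LScale (a * b) s)
| leqv_scale1 s : leqv (LScale 1 s) s
| leqv_scaleDr c s t : leqv (LScale c (LAdd s t)) (LAdd (LScale c s) (LScale c t))
| leqv_scaleDl a b s : leqv (LScale (a + b) s) (LAdd (LScale a s) (LScale b s))
| leqv_brDl s t u : leqv (LBr (LAdd s t) u) (LAdd (LBr s u) (LBr t u))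
| leqv_brDr s t u : leqv (LBr s (LAdd t u)) (LAdd (LBr s t) (LBr s u))
| leqv_brZl c s t : leqv (LBr (LScale c s) t) (LScale c (LBr s t))
| leqv_brZr c s t : leqv (LBr s (LScale c t)) (LScale c (LBr s t))
| leqv_brxx s : leqv (LBr s s) LZero
| leqv_jacobi s t u :
    leqv (LAdd (LAdd (LBr s (LBr t u)) (LBr t (LBr u s))) (LBr u (LBr s t)))
      LZero.

Section Free.
Variables (C : pzRingType) (Y : Type).
Local Notation term := (lterm C Y).
HB.instance Definition _ := gen_eqMixin term.
HB.instance Definition _ := gen_choiceMixin term.

Definition leqvb (s t : term) : bool := `[< leqv s t >].
Lemma leqvb_equiv : equiv_class_of leqvb.
Proof.
split=> [s|s t|t s u]; first exact/asboolP/leqv_refl.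
  by apply/asboolP/asboolP; apply: leqv_sym.
by move=> /asboolP st /asboolP tu; apply/asboolP/(leqv_trans st tu).
Qed.
Canonical leqvb_equiv_rel := EquivRelPack leqvb_equiv.
Canonical leqvb_encModRel := defaultEncModRel leqvb.

Definition freeLie : Type := {eq_quot leqvb}.
HB.instance Definition _ := Choice.on freeLie.

Definition fcls (s : term) : freeLie := \pi_{eq_quot leqvb} s.

Lemma fclsP s t : fcls s = fcls t <-> leqv s t.
Proof.
split=> [/eqmodP /asboolP //|st].
by apply/eqmodP/asboolP.
Qed.

Lemma fclsK (q : freeLie) : fcls (repr q) = q.
Proof. exact: reprK. Qed.

Lemma repr_fcls s : leqv (repr (fcls s)) s.
Proof. by apply/fclsP; rewrite fclsK. Qed.

Definition free_zero := fcls LZero.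
Definition free_opp (q : freeLie) := fcls (LOpp (repr q)).
Definition free_add (p q : freeLie) := fcls (LAdd (repr p) (repr q)).
Definition free_scale (c : C) (q : freeLie) := fcls (LScale c (repr q)).
Definition free_br (p q : freeLie) := fcls (LBr (repr p) (repr q)).

Lemma fcls_opp s : free_opp (fcls s) = fcls (LOpp s).
Proof. by apply/fclsP/leqv_opp/repr_fcls. Qed.
Lemma fcls_add s t : free_add (fcls s) (fcls t) = fcls (LAdd s t).
Proof. by apply/fclsP/leqv_add; apply: repr_fcls. Qed.
Lemma fcls_scale c s : free_scale c (fcls s) = fcls (LScale c s).
Proof. by apply/fclsP/leqv_scale/repr_fcls. Qed.
Lemma fcls_br s t : free_br (fcls s) (fcls t) = fcls (LBr s t).
Proof. by apply/fclsP/leqv_br; apply: repr_fcls. Qed.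
Let fclsE := (fcls_opp, fcls_add, fcls_scale, fcls_br).

Lemma free_addA : associative free_add.
Proof.
move=> p q r; rewrite -[p]fclsK -[q]fclsK -[r]fclsK !fclsE.
exact/fclsP/leqv_addA.
Qed.
Lemma free_addC : commutative free_add.
Proof.
by move=> p q; rewrite -[p]fclsK -[q]fclsK !fclsE; apply/fclsP/leqv_addC.
Qed.
Lemma free_add0 : left_id free_zero free_add.
Proof.
by move=> p; rewrite -[p]fclsK /free_zero !fclsE; apply/fclsP/leqv_add0.
Qed.
Lemma free_addN : left_inverse free_zero free_opp free_add.
Proof.
by move=> p; rewrite -[p]fclsK /free_zero !fclsE; apply/fclsP/leqv_addN.
Qed.
HB.instance Definition _ :=
  GRing.isZmodule.Build freeLie free_addA free_addC free_add0 free_addN.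

Lemma fclsD s t : fcls s + fcls t = fcls (LAdd s t).
Proof. exact: fcls_add. Qed.

Lemma free_scaleA a b q : free_scale a (free_scale b q) = free_scale (a * b) q.
Proof. by rewrite -[q]fclsK !fclsE; apply/fclsP/leqv_scaleA. Qed.
Lemma free_scale1 : left_id 1 free_scale.
Proof. by move=> q; rewrite -[q]fclsK !fclsE; apply/fclsP/leqv_scale1. Qed.
Lemma free_scaleDr : right_distributive free_scale +%R.
Proof.
move=> c p q; rewrite -[p]fclsK -[q]fclsK !(fclsD, fclsE).
exact/fclsP/leqv_scaleDr.
Qed.
Lemma free_scaleDl q : {morph free_scale^~ q : a b / a + b}.
Proof.
move=> a b; rewrite -[q]fclsK !(fclsD, fclsE).
exact/fclsP/leqv_scaleDl.
Qed.
HB.instance Definition _ := GRing.Zmodule_isLmodule.Build C freeLie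
  free_scaleA free_scale1 free_scaleDr free_scaleDl.

Lemma fclsZ c s : c *: fcls s = fcls (LScale c s).
Proof. exact: fcls_scale. Qed.

Lemma free_brDl p q r : free_br (p + q) r = free_br p r + free_br q r.
Proof.
rewrite -[p]fclsK -[q]fclsK -[r]fclsK !(fclsD, fclsE).
exact/fclsP/leqv_brDl.
Qed.
Lemma free_brDr p q r : free_br p (q + r) = free_br p q + free_br p r.
Proof.
rewrite -[p]fclsK -[q]fclsK -[r]fclsK !(fclsD, fclsE).
exact/fclsP/leqv_brDr.
Qed.
Lemma free_brZl (c : C) p q : free_br (c *: p) q = c *: free_br p q.
Proof.
rewrite -[p]fclsK -[q]fclsK !(fclsZ, fcls_br); exact/fclsP/leqv_brZl.
Qed.
Lemma free_brZr (c : C) p q : free_br p (c *: q) = c *: free_br p q.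
Proof.
rewrite -[p]fclsK -[q]fclsK !(fclsZ, fcls_br); exact/fclsP/leqv_brZr.
Qed.
Lemma free_brxx p : free_br p p = 0.
Proof. by rewrite -[p]fclsK fcls_br; apply/fclsP/leqv_brxx. Qed.
Lemma free_jacobi p q r :
  free_br p (free_br q r) + free_br q (free_br r p) + free_br r (free_br p q)
    = 0.
Proof.
rewrite -[p]fclsK -[q]fclsK -[r]fclsK !(fclsD, fclsE).
exact/fclsP/leqv_jacobi.
Qed.
HB.instance Definition _ := Lmodule_isLie.Build C freeLie free_brDl free_brDr
  free_brZl free_brZr free_brxx free_jacobi.

Definition fgen (y : Y) : freeLie := fcls (LVar y).

Lemma fclsBr s t : br (fcls s) (fcls t) = fcls (LBr s t).
Proof. exact: fcls_br. Qed.

Lemma fclsN s : - fcls s = fcls (LOpp s).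
Proof. exact: fcls_opp. Qed.

End Free.
Arguments freeLie C Y : clear implicits.
Arguments fgen {C Y}.

Section FreeLift.
Variables (C : pzRingType) (Y : Type) (M : lieAlgType C) (f : Y -> M).

Fixpoint leval (s : lterm C Y) : M :=
  match s with
  | LVar y => f y
  | LZero => 0
  | LOpp s => - leval s
  | LAdd s t => leval s + leval t
  | LScale c s => c *: leval s
  | LBr s t => br (leval s) (leval t)
  end.

Lemma leval_leqv s t : leqv s t -> leval s = leval t.
Proof.
elim=> {s t} //=.
- by move=> s t u _ -> _ ->.
- by move=> s t _ ->.
- by move=> s s' t t' _ -> _ ->.
- by move=> c s s' _ ->.
- by move=> s s' t t' _ -> _ ->.
- by move=> s t u; rewrite addrA.
- by move=> s t; rewrite addrC.
- by move=> s; rewrite add0r.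
- by move=> s; rewrite addNr.
- by move=> a b s; rewrite scalerA.
- by move=> s; rewrite scale1r.
- by move=> c s t; rewrite scalerDr.
- by move=> a b s; rewrite scalerDl.
- by move=> s t u; rewrite brDl.
- by move=> s t u; rewrite brDr.
- by move=> c s t; rewrite brZl.
- by move=> c s t; rewrite brZr.
- by move=> s; rewrite brxx.
- by move=> s t u; rewrite jacobi.
Qed.

Definition free_lift (q : freeLie C Y) : M := leval (repr q).

Lemma free_lift_cls s : free_lift (fcls s) = leval s.
Proof. exact/leval_leqv/repr_fcls. Qed.

Lemma free_lift_gen y : free_lift (fgen y) = f y.
Proof. exact: free_lift_cls. Qed.

Lemma free_lift_is_linear : linear free_lift.
Proof.
move=> c p q; rewrite -[p]fclsK -[q]fclsK fclsZ fclsD.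
by rewrite !free_lift_cls.
Qed.
HB.instance Definition _ := GRing.isLinear.Build C (freeLie C Y) M _ free_lift
  free_lift_is_linear.

Lemma free_lift_is_lie p q :
  free_lift (br p q) = br (free_lift p) (free_lift q).
Proof. by rewrite -[p]fclsK -[q]fclsK fclsBr !free_lift_cls. Qed.
HB.instance Definition _ := isLieMorphism.Build C (freeLie C Y) M free_lift
  free_lift_is_lie.

Lemma free_lift_unique (g : lieMorph (freeLie C Y) M) :
  (forall y, g (fgen y) = f y) -> g =1 free_lift.
Proof.
move=> gE q; rewrite -[q]fclsK free_lift_cls; elim: (repr q) => {q} //=.
- by have -> : fcls LZero = 0 :> freeLie C Y by []; rewrite linear0.
- by move=> s <-; rewrite -fclsN linearN.
- by move=> s <- t <-; rewrite -fclsD linearD.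
- by move=> c s <-; rewrite -fclsZ linearZ.
- by move=> s <- t <-; rewrite -fclsBr lie_morph.
Qed.

End FreeLift.

Section Commuting.
Variables (C : pzRingType) (Y : Type) (M : lieAlgType C).
Variable h : lieMorph (freeLie C Y) M.

Lemma centralize_gens (z : M) :
  (forall y, br z (h (fgen y)) = 0) -> forall q, br z (h q) = 0.
Proof.
move=> zh q; rewrite -[q]fclsK; elim: (repr q) => {q} //=.
- have -> : fcls LZero = 0 :> freeLie C Y by [].
  by rewrite linear0 brx0.
- by move=> s zs; rewrite -fclsN linearN /= brxN zs oppr0.
- by move=> s zs t zt; rewrite -fclsD linearD /= brDr zs zt addr0.
- by move=> c s zs; rewrite -fclsZ linearZ /= brZr zs scaler0.
- move=> s zs t zt; rewrite -fclsBr lie_morph.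
  have := jacobi z (h (fcls s)) (h (fcls t)).
  by rewrite zs (brC _ z) zt oppr0 !brx0 !addr0.
Qed.

Lemma commuting_gens_derived :
  (forall y z, br (h (fgen y)) (h (fgen z)) = 0) ->
  forall q, lsub_set (derived_subalg (freeLie C Y)) q -> h q = 0.
Proof.
move=> comm q.
have hh p r : br (h p) (h r) = 0.
  apply: centralize_gens => y; rewrite brC; apply/eqP; rewrite oppr_eq0.
  by apply/eqP/centralize_gens.
move/(_ (h @^-1` [set 0])); apply; first split; rewrite /preimage /=.
- exact: linear0.
- by move=> x y hx hy; rewrite linearD /= hx hy addr0.
- by move=> c x hx; rewrite linearZ /= hx scaler0.
- by move=> _ [[u v] _ <-] /=; rewrite lie_morph.
Qed.

End Commuting.

Record set_arrangement (X : finType) := SetArrangement {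
  blocks :> {set {set X}};
  arr_carrier : (1 < #|X|)%N;
  arr_card : forall A, A \in blocks -> (1 < #|A|)%N;
  arr_meet : forall A B, A \in blocks -> B \in blocks -> A != B ->
    (#|A :&: B| <= 1)%N;
  arr_cover : finset.cover blocks = [set: X]%SET
}.

Definition block (X : finType) (AA : set_arrangement X) : finType :=
  {A : {set X} | A \in blocks AA}.

Definition freeOn (C : pzRingType) (X : finType) (A : {set X}) :
  lieAlgType C := freeLie C {x : X | x \in A}.
Arguments freeOn C {X} A.

Definition free_incl (C : pzRingType) (X : finType) (A : {set X}) :
    lieMorph (freeOn C A) (freeLie C X) :=
  free_lift (fun a : {x : X | x \in A} => fgen (val a)).
Arguments free_incl C {X} A.

Lemma free_incl_gen (C : pzRingType) (X : finType) (A : {set X})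
    (a : {x : X | x \in A}) : free_incl C A (fgen a) = fgen (val a).
Proof. exact: free_lift_gen. Qed.

Record relators (C : comPzRingType) (X : finType) (AA : set_arrangement X) :=
  Relators {
    rel_set :> forall A : block AA, set (freeOn C (val A));
    rel_derived : forall A : block AA, @rel_set A `<=` derived_subalg (freeOn C (val A))
  }.
Arguments relators C {X} AA.
Arguments rel_set {C X AA} r A.

Section ArrLie.
Variables (C : comPzRingType) (X : finType) (AA : set_arrangement X).
Variable R : relators C AA.

(** The case [x = y] contributes nothing, since the blocks cover [X]. *)
Definition arr_relations : set (freeLie C X) :=
  [set r | exists x y : X,
     ~ (exists2 A, A \in blocks AA & ([set x; y]%SET \subset A)) /\
     r = br (fgen x) (fgen y)]
  `|` \bigcup_(A in [set: block AA]) (free_incl C (val A) @` rel_set R A).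

Definition arr_lie : lieAlgType C := lie_quot arr_relations.

Definition loc_lie (A : block AA) : lieAlgType C := lie_quot (rel_set R A).

Definition arr_gen (x : X) : arr_lie := quot_proj arr_relations (fgen x).

Definition loc_gen (A : block AA) (a : {x : X | x \in val A}) : loc_lie A :=
  quot_proj (rel_set R A) (fgen a).

Definition s_pre (A : block AA) : freeOn C (val A) -> arr_lie :=
  quot_proj arr_relations \o free_incl C (val A).
HB.instance Definition _ (A : block AA) := LieMorphism.on (@s_pre A).

Lemma s_pre_rel (A : block AA) w : rel_set R A w -> @s_pre A w = 0.
Proof.
move=> Rw; rewrite -(linear0 (quot_proj arr_relations)).
apply/quot_projP; rewrite subr0; apply: sub_ideal_span; right.
by exists A => //; exists w.
Qed.

Definition s_loc (A : block AA) : lieMorph (loc_lie A) arr_lie :=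
  quot_lift (@s_pre_rel A).

Lemma s_gen (A : block AA) a : s_loc A (loc_gen a) = arr_gen (val a).
Proof.
rewrite [LHS]quot_lift_proj; congr (quot_proj _ _); exact: free_lift_gen.
Qed.

Definition pi_gen (A : block AA) (x : X) : loc_lie A :=
  if insub x is Some a then loc_gen a else 0.

Definition pi_pre (A : block AA) : lieMorph (freeLie C X) (loc_lie A) :=
  free_lift (pi_gen A).

Lemma pi_pre_gen (A : block AA) x : pi_pre A (fgen x) = pi_gen A x.
Proof. exact: free_lift_gen. Qed.

Lemma pi_gen_in (A : block AA) (a : {x : X | x \in val A}) :
  pi_gen A (val a) = loc_gen a.
Proof. by rewrite /pi_gen valK. Qed.

Lemma pi_gen_out (A : block AA) x : x \notin val A -> pi_gen A x = 0.
Proof. by move=> xA; rewrite /pi_gen insubN. Qed.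

Lemma pi_gen_br (A : block AA) x y :
  ~~ ((x \in val A) && (y \in val A)) -> br (pi_gen A x) (pi_gen A y) = 0.
Proof.
by rewrite negb_and => /orP[] /pi_gen_out ->; rewrite ?br0x ?brx0.
Qed.

Lemma pi_pre_rel (A : block AA) w : arr_relations w -> pi_pre A w = 0.
Proof.
case=> [[x [y [xyA ->]]]|[B _ [v Rv <-]]].
  rewrite lie_morph !pi_pre_gen pi_gen_br //; apply/negP => /andP[xA yA].
  apply: xyA; exists (val A); first exact: valP.
  by apply/fintype.subsetP => z /set2P[] ->.
have [AB|neqAB] := eqVneq A B.
  subst B; have /free_lift_unique E a :
      (pi_pre A \o free_incl C (val A)) (fgen a) = loc_gen a.
    by rewrite /= free_incl_gen pi_pre_gen pi_gen_in.
  have /free_lift_unique E' a : quot_proj (rel_set R A) (fgen a) = loc_gen a.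
    by [].
  transitivity (quot_proj (rel_set R A) v); first by rewrite E' -E.
  rewrite -(linear0 (quot_proj (rel_set R A))).
  by apply/quot_projP; rewrite subr0; apply: sub_ideal_span.
apply: (@commuting_gens_derived _ _ _ (pi_pre A \o free_incl C (val B))).
  move=> a b; rewrite /= !free_incl_gen !pi_pre_gen.
  case ab: ((val a \in val A) && (val b \in val A)); last first.
    by rewrite pi_gen_br ?ab.
  suff -> : a = b by rewrite brxx.
  apply: val_inj; case/andP: ab => aA bA.
  have /card_le1_eqP := arr_meet (valP A) (valP B) neqAB.
  have aB : val a \in val B by apply: valP.
  have bB : val b \in val B by apply: valP.
  by apply; rewrite inE ?aA ?bA ?aB ?bB.
exact: (rel_derived Rv).
Qed.

Definition pi_loc (A : block AA) : lieMorph arr_lie (loc_lie A) :=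
  quot_lift (@pi_pre_rel A).

Lemma pi_arr_gen (A : block AA) (a : {x : X | x \in val A}) :
  pi_loc A (arr_gen (val a)) = loc_gen a.
Proof. by rewrite [LHS]quot_lift_proj pi_pre_gen pi_gen_in. Qed.

Lemma pi_arr_gen0 (A : block AA) x : x \notin val A -> pi_loc A (arr_gen x) = 0.
Proof. by move=> xA; rewrite [LHS]quot_lift_proj pi_pre_gen pi_gen_out. Qed.

Definition s_der (A : block AA) :
  lieMorph (derived (loc_lie A)) (derived arr_lie) := der_morph (s_loc A).

Definition pi_der (A : block AA) :
  lieMorph (derived arr_lie) (derived (loc_lie A)) := der_morph (pi_loc A).

Definition s_sum (v : dsum (fun A : block AA => derived (loc_lie A))) :
  derived arr_lie := \sum_A s_der A (v A).

Definition pi_sum (x : derived arr_lie) :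
  dsum (fun A : block AA => derived (loc_lie A)) := fun A => pi_der A x.

Lemma s_sum_is_linear : linear s_sum.
Proof.
move=> c u v; rewrite /s_sum scaler_sumr -big_split; apply: eq_bigr => A _ /=.
exact: linearP.
Qed.
HB.instance Definition _ := GRing.isLinear.Build C _ _ _ s_sum s_sum_is_linear.

Lemma pi_sum_is_linear : linear pi_sum.
Proof.
by move=> c x y; apply: functional_extensionality_dep => A; apply: linearP.
Qed.
HB.instance Definition _ :=
  GRing.isLinear.Build C _ _ _ pi_sum pi_sum_is_linear.

End ArrLie.

(* Main.v *)
Require Import Defs.
From HB Require Import structures.
From mathcomp Require Import all_boot all_order all_algebra.
From mathcomp Require Import boolp classical_sets.

Set Implicit Arguments.
Unset Strict Implicit.
Unset Printing Implicit Defensive.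

Import GRing.Theory.
Local Open Scope classical_set_scope.
Local Open Scope ring_scope.

(** [pi'] is a left inverse of [s'], because distinct blocks share at most one
    generator.  Hence surjectivity of [s'] makes [pi'] injective, and
    injectivity of [pi'] can be used to check identities blockwise.  Under
    condition 2 the sum of the [im s_A'] is an ideal containing all brackets of
    generators, so the quotient by it is abelian and it is all of [L']. *)

(** * Sums of ideals and elements of the derived algebra *)

Section LieGeneral.
Variables (C : pzRingType) (L : lieAlgType C).

Lemma br_sumr (I : finType) (x : L) (v : I -> L) :
  br x (\sum_i v i) = \sum_i br x (v i).
Proof. exact: (big_morph (br x) (brDr x) (brx0 x)). Qed.

Lemma br_brl (x y z : L) : br (br x y) z = br x (br y z) - br y (br x z).
Proof.
have /eqP := jacobi x y z; rewrite [br z (br x y)]brC subr_eq0 => /eqP <-.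
by rewrite [br z x]brC brxN.
Qed.

Lemma is_submodule_sum (I : finType) (S : I -> set L) :
  (forall i, is_submodule (S i)) -> is_submodule (submodule_sum S).
Proof.
move=> Ssub; split=> [|_ _ [u Su ->] [v Sv ->]|c _ [u Su ->]].
- by exists (fun=> 0); [move=> i; case: (Ssub i)|rewrite big1].
- exists (fun i => u i + v i); last by rewrite big_split.
  by move=> i; case: (Ssub i) => _ + _; apply.
- exists (fun i => c *: u i); last by rewrite scaler_sumr.
  by move=> i; case: (Ssub i) => _ _; apply.
Qed.

Lemma is_lie_ideal_sum (I : finType) (S : I -> set L) :
  (forall i, is_lie_ideal (S i)) -> is_lie_ideal (submodule_sum S).
Proof.
move=> Sid; split=> [|x _ [u Su ->]].
  by apply: is_submodule_sum => i; case: (Sid i).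
exists (fun i => br x (u i)); last exact: br_sumr.
by move=> i; case: (Sid i) => _; apply.
Qed.

Lemma sub_submodule_sum (I : finType) (S : I -> set L) i :
  (forall j, is_submodule (S j)) -> S i `<=` submodule_sum S.
Proof.
move=> Ssub x Sx; exists (fun j => if j == i then x else 0).
  by move=> j; case: eqP => [->//|_]; case: (Ssub j).
by rewrite -big_mkcond big_pred1_eq.
Qed.

(** This packaging lets [s_der] and [pi_sum] be applied to a bracket of arbitrary elements of the
    ambient algebra. *)
Definition derived_bracket (x y : L) : derived L :=
  @Subalg C L (derived_subalg L) (br x y) (asboolT (derived_br x y)).

Lemma derived_sub (T : set L) (z : derived L) : is_submodule T ->
  (forall x y, T (br x y)) -> T (val z).
Proof.
move=> Tsub Tbr; apply: (subalg_set z) => // _ [[x y] _ <-]; exact: Tbr.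
Qed.

Lemma derived_eq0 (M : lieAlgType C) (f : lieMorph L M) (z : derived L) :
  (forall x y, f (br x y) = 0) -> f (val z) = 0.
Proof.
move=> f0; apply: (@derived_sub (f @^-1` [set 0])) => //.
split=> [|x y fx fy|c x fx]; rewrite /preimage /=; first exact: linear0.
  by rewrite linearD /= fx fy addr0.
by rewrite linearZ /= fx scaler0.
Qed.

End LieGeneral.

(** * Induction on generators, ideals and abelian quotients *)

Lemma freeLie_ind (C : pzRingType) (Y : Type) (P : set (freeLie C Y)) :
  is_submodule P -> (forall y, P (fgen y)) ->
  (forall p q, P p -> P q -> P (br p q)) -> forall q, P q.
Proof.
move=> [P0 PD PZ] Pgen Pbr q; rewrite -[q]fclsK; elim: (repr q) => {q} //=.
- by move=> s Ps; rewrite -fclsN -scaleN1r; apply: PZ.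
- by move=> s Ps t Pt; rewrite -fclsD; apply: PD.
- by move=> c s Ps; rewrite -fclsZ; apply: PZ.
- by move=> s Ps t Pt; rewrite -fclsBr; apply: Pbr.
Qed.

Section Arrangement.
Variables (C : comPzRingType) (X : finType) (AA : set_arrangement X).
Variable R : relators C AA.
Local Notation L := (arr_lie R).

Lemma arr_lie_ind (P : set L) :
  is_submodule P -> (forall x, P (arr_gen R x)) ->
  (forall p q, P p -> P q -> P (br p q)) -> forall q, P q.
Proof.
move=> [P0 PD PZ] Pgen Pbr q; rewrite -[q]quot_reprK.
apply: (@freeLie_ind _ _ (quot_proj (arr_relations R) @^-1` P)) => //.
  split=> [|u v Pu Pv|c u Pu]; rewrite /preimage /= ?linear0 //.
    by rewrite linearD; apply: PD.
  by rewrite linearZ; apply: PZ.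
by move=> u v Pu Pv; rewrite /preimage /= lie_morph; apply: Pbr.
Qed.

(** The elements whose left bracket maps [T] into itself form a subalgebra, because ad [p, q] = ad p
    ad q - ad q ad p, and a subalgebra containing the generators is everything. *)
Lemma is_lie_ideal_gens (T : set L) : is_submodule T ->
  (forall x y, T y -> T (br (arr_gen R x) y)) -> is_lie_ideal T.
Proof.
move=> Tsub Tgen; split=> // x; case: (Tsub) => T0 TD TZ.
apply: (@arr_lie_ind [set x | forall y, T y -> T (br x y)]) => //=.
- split=> [y _|u v Tu Tv y Ty|c u Tu y Ty].
  + by rewrite br0x.
  + by rewrite brDl; apply: TD; [apply: Tu|apply: Tv].
  + by rewrite brZl; apply/TZ/Tu.
- move=> p q Tp Tq y Ty; rewrite br_brl -scaleN1r.
  by apply: TD; [|apply: TZ]; [apply/Tp/Tq|apply/Tq/Tp].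
Qed.

(** Modulo [T] the generators commute. By the Jacobi identity the elements commuting with a given
    one form a subalgebra, so the quotient is abelian. *)
Lemma lie_ideal_brackets (T : set L) : is_lie_ideal T ->
  (forall x y, T (br (arr_gen R x) (arr_gen R y))) -> forall u v, T (br u v).
Proof.
move=> [[T0 TD TZ] Tbr] Tgen.
have TbrC u v : T (br u v) -> T (br v u).
  by move=> Tuv; rewrite brC -scaleN1r; apply: TZ.
have step u : (forall x, T (br u (arr_gen R x))) -> forall v, T (br u v).
  move=> Tu; apply: (@arr_lie_ind [set v | T (br u v)]) => //=.
    split=> [|v w Tv Tw|c v Tv] /=; first by rewrite brx0.
      by rewrite brDr; apply: TD.
    by rewrite brZr; apply: TZ.
  move=> p q Tp Tq; apply/TbrC; rewrite br_brl -scaleN1r.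
  by apply: TD; [|apply: TZ]; apply/Tbr/TbrC.
(* [step] first reduces the right factor to a generator [x]; after a swap it reduces [u] to a
   generator too. *)
by move=> u; apply/step => x; apply/TbrC/step => y; apply: Tgen.
Qed.

(** * The projections [pi_loc] composed with the maps [s_loc] *)

Lemma s_loc_proj (A : block AA) (a : {x : X | x \in val A}) :
  s_loc R A (quot_proj (rel_set R A) (fgen a)) = arr_gen R (val a).
Proof. exact: s_gen. Qed.

(** Precomposed with the projection from [freeOn C (val A)], both the composite and the identity
    send [fgen a] to [loc_gen R a], so they agree by uniqueness of the free lift. *)
Lemma pi_s_loc (A : block AA) : cancel (s_loc R A) (pi_loc R A).
Proof.
move=> q; rewrite -[q]quot_reprK; set r := repr q.
have /free_lift_unique E a :
    (pi_loc R A \o (s_loc R A \o quot_proj (rel_set R A))) (fgen a)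
      = loc_gen R a.
  by rewrite -(pi_arr_gen R a) -s_loc_proj.
have /free_lift_unique E' a : quot_proj (rel_set R A) (fgen a) = loc_gen R a.
  by [].
exact: etrans (E r) (esym (E' r)).
Qed.

(** Generators outside [B] are killed; if both survive, they lie in the intersection of two distinct
    blocks and hence coincide. *)
Lemma pi_loc_comm (A B : block AA) (x y : X) : A != B ->
  x \in val A -> y \in val A ->
  br (pi_loc R B (arr_gen R x)) (pi_loc R B (arr_gen R y)) = 0.
Proof.
move=> AB xA yA.
have [xB|/pi_arr_gen0 -> //] := boolP (x \in val B); last by rewrite br0x.
have [yB|/pi_arr_gen0 -> //] := boolP (y \in val B); last by rewrite brx0.
suff -> : x = y by rewrite brxx.
have /card_le1_eqP := arr_meet (valP A) (valP B) AB.
by apply; rewrite inE ?xA ?yA.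
Qed.

Lemma pi_s_loc_neq (A B : block AA) (z : derived (loc_lie R A)) : A != B ->
  pi_loc R B (s_loc R A (val z)) = 0.
Proof.
move=> AB; apply: (derived_eq0 (f := pi_loc R B \o s_loc R A)) => p q.
rewrite -[p]quot_reprK -[q]quot_reprK.
rewrite -quot_proj_is_lie.
(* On the free Lie algebra, [h] sends generators to commuting elements by [pi_loc_comm], hence kills
   all brackets. *)
pose h : lieMorph (freeOn C (val A)) (loc_lie R B) :=
  pi_loc R B \o (s_loc R A \o quot_proj (rel_set R A)).
apply: (commuting_gens_derived (h := h)); last exact: derived_br.
move=> a b; have hgen c : h (fgen c) = pi_loc R B (arr_gen R (val c)).
  by rewrite -s_loc_proj.
rewrite !hgen.
by apply: pi_loc_comm AB _ _; apply: valP.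
Qed.

Lemma pi_s_der (A B : block AA) (z : derived (loc_lie R A)) : A != B ->
  pi_der R B (s_der R A z) = 0.
Proof. by move=> AB; apply/val_inj/pi_s_loc_neq. Qed.

Lemma pi_s_derK (A : block AA) : cancel (s_der R A) (pi_der R A).
Proof. by move=> z; apply/val_inj/pi_s_loc. Qed.

(** The block matrix of the composite is the identity: [pi_s_derK] gives the diagonal, [pi_s_der]
    the vanishing off it. *)
Lemma pi_s_sum : cancel (@s_sum C X AA R) (@pi_sum C X AA R).
Proof.
move=> v; apply: functional_extensionality_dep => A.
rewrite /pi_sum /s_sum linear_sum (bigD1 A) //= pi_s_derK big1 ?addr0 //.
by move=> B BA; apply: pi_s_der.
Qed.

(** * The images as ideals, and their sum *)

Lemma im_s_der_ideal (A : block AA) :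
  (forall x, x \notin val A -> forall z, range (s_der R A) z ->
     br (arr_gen R x) (val z) = 0) ->
  is_lie_ideal (val @` range (s_der R A) : set L).
Proof.
move=> ann; have Isub : is_submodule (val @` range (s_der R A) : set L).
  case: (image_submodule (s_der R A)) => I0 ID IZ; split.
  - by exists 0.
  - by move=> _ _ [u Iu <-] [v Iv <-]; exists (u + v) => //; apply: ID.
  - by move=> c _ [u Iu <-]; exists (c *: u) => //; apply: IZ.
apply: is_lie_ideal_gens => // x _ [_ [w _ <-] <-].
have [xA|xA] := boolP (x \in val A); last first.
  by rewrite ann //; case: Isub.
(* A generator in [A] already acts inside the localized algebra, so its bracket with the image of
   [w] is the image of [u]. *)
pose u := derived_bracket (loc_gen R (Sub x xA)) (val w).
exists (s_der R A u) => //; apply: etrans (lie_morph _ _) _.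
by congr br; apply: s_gen.
Qed.

Lemma arr_gen_br_in_im (x y : X) :
  br (arr_gen R x) (arr_gen R y) = 0 \/
  exists A : block AA,
    (val @` range (s_der R A) : set L) (br (arr_gen R x) (arr_gen R y)).
Proof.
have [[A AAA /fintype.subsetP sub]|noA] :=
  pselect (exists2 A, A \in blocks AA & [set x; y]%SET \subset A).
  have xA : x \in A by apply: sub; rewrite !inE eqxx.
  have yA : y \in A by apply: sub; rewrite !inE eqxx orbT.
  right; exists (Sub A AAA).
  pose gen := @loc_gen C X AA R (Sub A AAA).
  pose u := derived_bracket (gen (Sub x xA)) (gen (Sub y yA)).
  exists (s_der R _ u) => //; apply: etrans (lie_morph _ _) _.
  by congr br; apply: s_gen.
left; rewrite -lie_morph -(linear0 (quot_proj (arr_relations R))).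
apply/quot_projP; rewrite subr0; apply: sub_ideal_span; left.
by exists x, y.
Qed.

Lemma derived_sum_im :
  (forall A, is_lie_ideal (val @` range (s_der R A) : set L)) ->
  [set: derived L] = submodule_sum (fun A => range (s_der R A)).
Proof.
move=> Iid; pose J := submodule_sum (fun A => val @` range (s_der R A) : set L).
have Jid : is_lie_ideal J := is_lie_ideal_sum Iid.
apply/seteqP; split=> // y _.
have [v Iv Ey] : J (val y).
  apply: derived_sub; first by case: Jid.
  apply: lie_ideal_brackets => // a b.
  have [->|[A IA]] := arr_gen_br_in_im a b; first by case: Jid => -[].
  by apply: (sub_submodule_sum (i := A)) IA => B; case: (Iid B).
(* The summands [v A] live in [L]; [cid2] chooses preimages of them in [derived L]. *)
exists (fun A => s2val (cid2 (Iv A))) => [A|]; first by case: cid2.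
apply: val_inj; rewrite Ey linear_sum; apply: eq_bigr => A _.
by case: cid2.
Qed.

(** * Internal and external direct sum decompositions *)

Section Decomposition.
Local Notation im A := (lie_im (s_der R A)).
Local Notation dsumIm := (dsum (fun A : block AA => subalg (im A))).
Local Notation dsumLoc := (dsum (fun A : block AA => derived (loc_lie R A))).

Definition pi_im (v : dsumIm) : dsumLoc := fun A => pi_der R A (val (v A)).

Lemma pi_im_is_linear : linear pi_im.
Proof.
by move=> c u v; apply: functional_extensionality_dep => A; apply: linearP.
Qed.
HB.instance Definition _ := GRing.isLinear.Build C dsumIm dsumLoc _ pi_im
  pi_im_is_linear.

Lemma pi_im_is_lie u v : pi_im (br u v) = br (pi_im u) (pi_im v).
Proof. by apply: functional_extensionality_dep => A; apply: lie_morph. Qed.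
HB.instance Definition _ := isLieMorphism.Build C dsumIm dsumLoc pi_im
  pi_im_is_lie.

Lemma pi_im_bij : bijective pi_im.
Proof.
pose s_im (w : dsumLoc) : dsumIm := fun A => @Subalg C _ (im A) (s_der R A (w A))
  (asboolT (ex_intro2 _ _ (w A) I erefl)).
exists s_im => [v|w]; apply: functional_extensionality_dep => A.
  apply: val_inj; rewrite -[LHS]/(s_der R A (pi_der R A (val (v A)))).
  case: (subalg_set (v A)) => w _ <-.
  by rewrite pi_s_derK.
exact: pi_s_derK.
Qed.

Definition im_sum (v : dsumIm) : derived L := \sum_A val (v A).

Lemma im_sumE v : im_sum v = s_sum (pi_im v).
Proof.
apply: eq_bigr => A _; case: (subalg_set (v A)) => w _ Ew.
by rewrite /pi_im -Ew pi_s_derK.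
Qed.

Lemma pi_im_sum v : pi_sum (im_sum v) = pi_im v.
Proof. by rewrite im_sumE pi_s_sum. Qed.

Lemma im_sum_is_linear : linear im_sum.
Proof. by move=> c u v; rewrite !im_sumE !linearP. Qed.
HB.instance Definition _ := GRing.isLinear.Build C dsumIm (derived L) _ im_sum
  im_sum_is_linear.

Lemma pi_sum_br (x y : derived L) :
  pi_sum (br x y) = br (pi_sum x) (pi_sum y) :> dsumLoc.
Proof. by apply: functional_extensionality_dep => A; apply: lie_morph. Qed.

(** Both [pi_sum] and its composite [pi_im] with [im_sum] preserve brackets, so the two sides agree
    after the injective [pi_sum]. *)
Lemma im_sum_is_lie (pi_inj : injective (@pi_sum C X AA R)) u v :
  im_sum (br u v) = br (im_sum u) (im_sum v).
Proof. by apply: pi_inj; rewrite pi_sum_br !pi_im_sum lie_morph. Qed.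

Lemma im_sum_bij : injective (@pi_sum C X AA R) -> bijective im_sum.
Proof.
move=> pi_inj; have [h ph hp] := pi_im_bij.
exists (h \o @pi_sum C X AA R) => x /=; first by rewrite pi_im_sum ph.
by apply: pi_inj; rewrite pi_im_sum hp.
Qed.

End Decomposition.

End Arrangement.

Theorem theorem2p7 (C : comPzRingType) (X : finType) (AA : set_arrangement X)
    (R : relators C AA) :
  [<-> forall (A : block AA) (x : X), x \notin val A ->
         forall z : derived (arr_lie R), lsub_set (lie_im (s_der R A)) z ->
           br (arr_gen R x) (val z) = 0;
       forall A : block AA,
         is_lie_ideal (val @` lsub_set (lie_im (s_der R A)) : set (arr_lie R));
       [set: derived (arr_lie R)]
         = submodule_sum (fun A : block AA => lsub_set (lie_im (s_der R A)));
       forall y : derived (arr_lie R), exists v, s_sum v = y;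
       injective (@pi_sum C X AA R)]
  /\ (injective (@pi_sum C X AA R) ->
       lie_internal_dsum (fun A : block AA => lie_im (s_der R A)) /\
       lie_isomorphic (dsum (fun A : block AA => subalg (lie_im (s_der R A))))
                      (dsum (fun A : block AA => derived (loc_lie R A)))).
Proof.
split.
  tfae.
  - by move=> ann A; apply: im_s_der_ideal => x xA z; apply: ann.
  - exact: derived_sum_im.
  - move=> E y; have: [set: derived (arr_lie R)] y by [].
    rewrite E => -[v Sv ->]; exists (fun A => s2val (cid2 (Sv A))).
    by apply: eq_bigr => A _; case: cid2.
  (* A surjective map with a left inverse is bijective, so the left inverse is injective. *)
  - move=> surj x y; have [[u <-] [v <-]] := (surj x, surj y).
    by rewrite !pi_s_sum => ->.
  - move=> pi_inj A x xA z [w _ <-].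
    suff: derived_bracket (arr_gen R x) (val (s_der R A w)) = 0.
      by move/(congr1 val).
    apply: pi_inj; rewrite linear0; apply: functional_extensionality_dep => B.
    apply: val_inj.
    transitivity (pi_loc R B (br (arr_gen R x) (s_loc R A (val w)))) => //.
    rewrite lie_morph.
    (* In block [A] the factor [x] dies, since it lies outside [A]; in any other block the factor
       from the image of [s_loc] dies. *)
    have [<-|AB] := eqVneq A B; first by rewrite pi_arr_gen0 ?br0x.
    by rewrite [X in br _ X](pi_s_loc_neq w AB) brx0.
move=> pi_inj; split; last first.
  by exists (pi_im (R := R)); apply: pi_im_bij.
(* The Lie morphism structure on [im_sum] is packed locally because it depends on [pi_inj]. *)
pose m := isLieMorphism.Build C _ _ (im_sum (R := R)) (im_sum_is_lie pi_inj).
exists (HB.pack_for (lieMorph _ _) (im_sum (R := R)) m).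
by split=> //; apply: im_sum_bij.
Qed.
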